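(* Let $M$ be a $\sigma$-precompact pointed metric space. Then every closed linear subspace $Y$ of $\mathrm{Lip}_0(M)$ with $Y\subset\mathrm{SNA}(M)$ is separable and isomorphic to a polyhedral Banach space.
   Context: All vector spaces are real. A pointed metric space $(M,\rho)$ is a metric space with at least 2 points and a distinguished point $0\in M$. $\mathrm{Lip}_0(M)$ is the Banach space of all Lipschitz functions $f:M\to\mathbb{R}$ with $f(0)=0$, normed by the Lipschitz constant $\|f\|=\sup\{|f(x)-f(y)|/\rho(x,y): x,y\in M,\ x\neq y\}$. A function $f\in\mathrm{Lip}_0(M)$ attains its norm strongly if there are $x\neq y$ in $M$ with $\|f\|=|f(x)-f(y)|/\rho(x,y)$; $\mathrm{SNA}(M)\subset\mathrm{Lip}_0(M)$ is the set of all such $f$. A metric space is $\sigma$-precompact if it is a countable union of precompact (i.e. totally bounded) sets. A Banach space is polyhedral if the closed unit ball of each of its finite-dimensional subspaces is a polytope (the convex hull of finitely many points). ''Isomorphic'' means linearly homeomorphic. *)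

(* Defs.v *)
From HB Require Import structures.
From mathcomp Require Import all_boot all_order all_algebra.
From mathcomp Require Import all_classical all_reals all_analysis.
From mathcomp Require Import ring.

Set Implicit Arguments.
Unset Strict Implicit.
Unset Printing Implicit Defensive.

Import Order.TTheory GRing.Theory Num.Theory.
Import numFieldNormedType.Exports.

Local Open Scope classical_set_scope.
Local Open Scope ring_scope.

Section Lip0.
Context {R : realType} {M : metricType R} (z : M).

Definition lip0 : {pred M -> R} := mem [set f : M -> R |
  (exists k : R, forall x y, `|f x - f y| <= k * mdist x y) /\ f z = 0].

Record Lip0 := MkLip0 { lip0_fun :> M -> R ; _ : lip0_fun \in lip0 }.

HB.instance Definition _ := [isSub for lip0_fun].
HB.instance Definition _ := [Choice of Lip0 by <:].

Lemma lip0_submod_closed : submod_closed lip0.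
Proof.
split; first by rewrite inE; split => //; exists 0 => x y; rewrite subrr normr0 mul0r.
move=> a f g; rewrite !inE => -[[k fk] f0] [[l gl] g0]; split; last first.
  by rewrite !fctE f0 g0 scaler0 addr0.
exists (`|a| * k + l) => x y; rewrite !fctE opprD addrACA -scalerBr.
rewrite (le_trans (ler_normD _ _))// mulrDl lerD// normrM -mulrA.
by rewrite ler_wpM2l.
Qed.

HB.instance Definition _ := GRing.isSubmodClosed.Build _ _ lip0 lip0_submod_closed.
HB.instance Definition _ := [SubChoice_isSubLmodule of Lip0 by <:].

(* If M = {z} the set of slopes is empty, and the norm is 0. *)
Definition slopes (f : M -> R) : set R :=
  [set `|f p.1 - f p.2| / mdist p.1 p.2 | p in [set p : M * M | p.1 != p.2]].

Definition lip_norm (f : Lip0) : R := sup (slopes f).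

Lemma Lip0_lipschitz (f : Lip0) :
  exists k, forall x y, `|f x - f y| <= k * mdist x y.
Proof. by have := valP f; rewrite /= inE => -[]. Qed.

Lemma Lip0_base (f : Lip0) : f z = 0.
Proof. by have := valP f; rewrite /= inE => -[]. Qed.

Lemma has_ubound_slopes (f : Lip0) : has_ubound (slopes f).
Proof.
have [k fk] := Lip0_lipschitz f; exists k => _ [[x y] /= xy <-].
by rewrite ler_pdivrMr ?mdist_gt0.
Qed.

Lemma lip_normP (f : Lip0) (x y : M) :
  `|f x - f y| <= lip_norm f * mdist x y.
Proof.
have [->|xy] := eqVneq x y; first by rewrite subrr normr0 mdistxx mulr0.
rewrite -ler_pdivrMr ?mdist_gt0//; apply: ub_le_sup.
  exact: has_ubound_slopes.
by exists (x, y).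
Qed.

Lemma lip_norm_le (f : Lip0) (k : R) : 0 <= k ->
  (forall x y, `|f x - f y| <= k * mdist x y) -> lip_norm f <= k.
Proof.
move=> k0 fk; rewrite /lip_norm; have [->|/set0P fn0] := eqVneq (slopes f) set0.
  by rewrite sup0.
apply: ge_sup => // _ [[x y] /= xy <-].
by rewrite ler_pdivrMr ?mdist_gt0.
Qed.

Lemma lip_norm_ge0 (f : Lip0) : 0 <= lip_norm f.
Proof.
rewrite /lip_norm; have [->|/set0P [r fr]] := eqVneq (slopes f) set0.
  by rewrite sup0.
apply: le_trans (ub_le_sup (has_ubound_slopes f) fr).
by case: fr => [[x y] /= _ <-]; rewrite divr_ge0 ?mdist_ge0.
Qed.

Lemma lip_normD (f g : Lip0) : lip_norm (f + g) <= lip_norm f + lip_norm g.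
Proof.
apply: lip_norm_le => [|x y]; first by rewrite addr_ge0 ?lip_norm_ge0.
rewrite [X in `|X|](_ : _ = (f x - f y) + (g x - g y)); last first.
  by rewrite /= !fctE opprD addrACA.
by rewrite (le_trans (ler_normD _ _))// mulrDl lerD ?lip_normP.
Qed.

Let lip_normZ_le (a : R) (f : Lip0) : lip_norm (a *: f) <= `|a| * lip_norm f.
Proof.
apply: lip_norm_le => [|x y]; first by rewrite mulr_ge0 ?lip_norm_ge0.
rewrite [X in `|X|](_ : _ = a * (f x - f y)); last by rewrite /= !fctE mulrBr.
by rewrite normrM -mulrA ler_wpM2l ?lip_normP.
Qed.

Lemma lip_normZ (a : R) (f : Lip0) : lip_norm (a *: f) = `|a| * lip_norm f.
Proof.
apply/eqP; rewrite eq_le lip_normZ_le /=.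
have [->|a0] := eqVneq a 0; first by rewrite normr0 mul0r lip_norm_ge0.
rewrite -ler_pdivlMl ?normr_gt0// -normfV.
by rewrite -{1}(scale1r f) -(mulVf a0) -scalerA lip_normZ_le.
Qed.

Lemma lip_norm0_eq0 (f : Lip0) : lip_norm f = 0 -> f = 0.
Proof.
move=> f0; apply: val_inj; apply/funext => x /=.
have := lip_normP f x z; rewrite f0 mul0r normr_le0 Lip0_base subr0.
by move/eqP.
Qed.

HB.instance Definition _ :=
  Lmodule_isNormed.Build R Lip0 lip_normD lip_normZ lip_norm0_eq0.

Lemma Lip0_normE (f : Lip0) : `|f| = lip_norm f.
Proof. by []. Qed.

Lemma Lip0_complete (F : set_system Lip0) :
  ProperFilter F -> cauchy F -> cvg F.
Proof.
move=> FF /cauchy_ballP Fc.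
have Fe (e : R) : 0 < e -> exists2 A, F A & forall f g, A f -> A g -> `|f - g| <= e.
  move=> e0; have /(_ _ e0) := Fc.
  move=> [[A B] /= [FA FB] AB]; exists (A `&` B); first exact: filterI.
  move=> f g [Af _] [_ Bg]; have := AB (f, g) (conj Af Bg).
  by rewrite -ball_normE /= => /ltW.
have evC x : cvg ((fun f : Lip0 => f x) @ F).
  apply: cauchy_cvg; apply/cauchy_ballP => e e0.
  have d0 : 0 < e / (mdist x z + 1) by rewrite divr_gt0// ltr_wpDl ?mdist_ge0.
  have [A FA Ad] := Fe _ d0.
  exists ((fun f : Lip0 => f x) @` A, (fun f : Lip0 => f x) @` A).
    by split; apply: (@filterS _ F _ A) FA => f Af; exists f.
  move=> [_ _] [[f Af <-] [g Ag <-]] /=.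
  rewrite -ball_normE /=.
  have := lip_normP (f - g) x z; rewrite !Lip0_base subr0 => /le_lt_trans; apply.
  rewrite (@le_lt_trans _ _ (e / (mdist x z + 1) * mdist x z))//.
    by rewrite ler_wpM2r ?mdist_ge0 ?Ad.
  rewrite mulrAC ltr_pdivrMr ?ltr_wpDl ?mdist_ge0// mulrDr mulr1.
  by rewrite ltrDl.
pose h x := lim ((fun f : Lip0 => f x) @ F).
have hk (e : R) A : F A -> (forall f g, A f -> A g -> `|f - g| <= e) ->
    forall f, A f -> forall x y, `|(f x - h x) - (f y - h y)| <= e * mdist x y.
  move=> FA Ae f Af x y.
  have : (fun g : Lip0 => `|(f x - g x) - (f y - g y)|) @ F -->
      `|(f x - h x) - (f y - h y)|.
    apply: cvg_norm; apply: cvgB; apply: cvgB; try exact: cvg_cst; exact: evC.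
  move=> fh; rewrite -(cvg_lim _ fh)//; apply: limr_le.
    by apply/cvg_ex; eexists; exact: fh.
  apply: (@filterS _ F _ A) FA => g Ag; have := lip_normP (f - g) x y => /le_trans; apply.
  by rewrite ler_wpM2r ?mdist_ge0 ?Ae.
have hL : h \in lip0.
  rewrite inE; split; last first.
    apply/cvg_lim => //; rewrite (_ : (fun f => _) = cst 0); first exact: cvg_cst.
    by apply/funext => f; rewrite Lip0_base.
  have [A FA A1] := Fe 1 ltr01.
  have [f Af] := filter_ex FA.
  exists (1 + lip_norm f) => x y.
  rewrite (_ : h x - h y = (f x - f y) - ((f x - h x) - (f y - h y))); last by ring.
  rewrite (le_trans (ler_normB _ _))// mulrDl [leRHS]addrC lerD ?lip_normP//.
  exact: (hk _ _ FA A1).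
apply/cvg_ex; exists (MkLip0 hL); apply/cvgrPdist_le => e e0.
have [A FA Ae] := Fe e e0.
near=> f; rewrite distrC; apply: lip_norm_le; first exact: ltW.
apply: (hk _ _ FA Ae); near: f; exact: FA.
Unshelve. all: by end_near. Qed.

HB.instance Definition _ := Uniform_isComplete.Build Lip0 Lip0_complete.

(* SNA = strongly norm-attaining *)
Definition SNA : set Lip0 :=
  [set f : Lip0 | exists x y : M, x != y /\ `|f| = `|f x - f y| / mdist x y].

End Lip0.

Arguments SNA {R M} z.

(* The library's `precompact` means relatively compact, which is stronger in an
   incomplete space. *)
Definition totally_bounded {R : realType} {M : metricType R} (A : set M) :=
  forall e : R, 0 < e ->
    exists2 F : set M, finite_set F & A `<=` \bigcup_(x in F) ball x e.

Definition sigma_precompact {R : realType} (M : metricType R) :=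
  exists2 A : nat -> set M,
    (forall n, totally_bounded (A n)) & \bigcup_n A n = [set: M].

Section normed_space.
Context {R : realType}.

Definition linear_subspace {V : lmodType R} (F : set V) :=
  submod_closed (mem F).

Definition linear_span {V : lmodType R} (A : set V) : set V :=
  smallest linear_subspace A.

Definition finite_dim_subspace {V : lmodType R} (F : set V) :=
  exists2 A : set V, finite_set A & F = linear_span A.

Definition convex_hull {V : lmodType R} (A : set V) : set V :=
  smallest (@convex_set R V) A.

Definition polytope {V : lmodType R} (P : set V) :=
  exists2 A : set V, finite_set A & P = convex_hull A.

Definition polyhedral (Z : normedModType R) :=
  forall F : set Z, finite_dim_subspace F ->
    polytope (F `&` [set v | `|v| <= 1]).

Definition separable_set {V : topologicalType} (Y : set V) :=
  exists2 D : set V, countable D & D `<=` Y /\ Y `<=` closure D.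

(* T is a linear bijection from Z onto Y, and S restricts to its inverse; Y
   carries the topology induced by V. *)
Definition isomorphic_to_subspace {V : normedModType R} (Y : set V)
    (Z : normedModType R) :=
  exists (T : {linear Z -> V}) (S : V -> Z),
    [/\ range T = Y, cancel T S, continuous T & {within Y, continuous S}].

End normed_space.

(* Main.v *)
From HB Require Import structures.
Require Import Defs.
From mathcomp Require Import all_boot all_order all_algebra.
From mathcomp Require Import all_classical all_reals all_analysis.
From mathcomp Require Import ring lra.

Set Implicit Arguments.
Unset Strict Implicit.
Unset Printing Implicit Defensive.

Import Order.TTheory GRing.Theory Num.Theory.
Import numFieldNormedType.Exports.

Local Open Scope classical_set_scope.
Local Open Scope ring_scope.

(** A function that strongly attains its norm has it as the slope of some pair of
    points, so the slope functionals form a boundary for [Y].  The pairs whose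
    points lie in the first [n] totally bounded pieces of [M], at distance at
    least [1 / n], give a norm totally bounded set of functionals.  Hence the
    boundary is covered by countably many totally bounded sets, and the argument
    is Fonf's for spaces with such a boundary.

    Take a finite net of the [n]-th set and multiply it by [1 + 1 / n].  If the net
    is fine enough, then for every nonzero [y] in [Y] some functional in one of
    these finite sets is strictly larger than the norm at [y] ([molecule_gt]).  The
    supremum of all of them is an equivalent norm on [Y], and near [y] it is a
    maximum over finitely many levels, since the later levels have norm close to
    1 and stay below the one that exceeds ([boundary_locally_attained]).

    A norm that is locally a maximum of finitely many functionals is such a
    maximum on each finite-dimensional subspace, by compactness of the sphere; the
    unit ball there is a polyhedron without rays, hence a polytope
    ([polyhedral_of_locally_attained]).

    Such a norm also forces separability ([separable_of_locally_attained]).  In a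
    suitable separable closed subspace, Ekeland's principle provides an almost
    nearest point to a given vector, and the local description of the norm at the
    difference shows that one can still get closer at a definite rate unless the
    difference vanishes.  This replaces the usual passage through the dual space. *)

(** * Functionals and subspaces *)

Lemma functionalDZ (R : pzRingType) (V : lmodType R) (g : V -> R) :
  scalar g -> forall (a : R) u v, g (u + a *: v) = g u + a * g v.
Proof. by move=> gL a u v; rewrite addrC gL addrC. Qed.

Lemma functional0 (R : pzRingType) (V : lmodType R) (g : V -> R) : scalar g -> g 0 = 0.
Proof.
move=> gL; have := gL (-1) 0 0.
by rewrite scaleN1r addNr mulN1r addNr.
Qed.

Lemma functionalZ (R : pzRingType) (V : lmodType R) (g : V -> R) : scalar g ->
  forall (a : R) v, g (a *: v) = a * g v.
Proof. by move=> gL a v; rewrite -[a *: v]addr0 gL functional0// addr0. Qed.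

Lemma functionalN (R : pzRingType) (V : lmodType R) (g : V -> R) : scalar g ->
  forall v, g (- v) = - g v.
Proof. by move=> gL v; rewrite -scaleN1r functionalZ// mulN1r. Qed.

Lemma functionalB (R : pzRingType) (V : lmodType R) (g : V -> R) : scalar g ->
  forall u v, g (u - v) = g u - g v.
Proof. by move=> gL u v; rewrite -scaleN1r functionalDZ// mulN1r. Qed.

Lemma subspaceZD (R : realType) (V : lmodType R) (F : set V) :
  linear_subspace F -> forall (a : R) u v, F u -> F v -> F (u + a *: v).
Proof.
by move=> [_ FD] a u v Fu Fv; rewrite addrC -in_setE; apply: FD; rewrite inE.
Qed.

Lemma subspaceB (R : realType) (V : lmodType R) (F : set V) :
  linear_subspace F -> forall u v, F u -> F v -> F (u - v).
Proof. by move=> FL u v Fu Fv; rewrite -scaleN1r; exact: subspaceZD. Qed.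

Lemma subspaceN (R : realType) (V : lmodType R) (F : set V) :
  linear_subspace F -> forall v, F v -> F (- v).
Proof.
move=> FL v Fv; rewrite -sub0r; apply: subspaceB => //.
by case: FL => + _; rewrite inE.
Qed.

(** * Bounded polyhedra are polytopes *)

Lemma exists_argmin (R : realDomainType) (T : eqType) (f : T -> R) (s : seq T) :
  s != [::] -> exists2 x, x \in s & forall y, y \in s -> f x <= f y.
Proof.
elim: s => // a [|b s] IH _; first by exists a => [|y]; rewrite ?inE// => /eqP->.
have [//|x xs xmin] := IH.
have [ax|xa] := leP (f a) (f x).
  exists a; first by rewrite mem_head.
  by move=> y; rewrite inE => /predU1P[->//|/xmin]; exact: le_trans.
exists x; first by rewrite inE xs orbT.
by move=> y; rewrite inE => /predU1P[->|/xmin//]; exact: ltW.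
Qed.

Lemma count_lt (T : eqType) (a b : pred T) (s : seq T) (x : T) :
  {in s, subpred a b} -> x \in s -> b x -> ~~ a x -> (count a s < count b s)%N.
Proof.
move=> ab xs bx ax.
have -> : count b s = (count a s + count (predD b a) s)%N.
  rewrite -count_predUI (_ : count (predI _ _) s = 0%N) ?addn0; last first.
    rewrite -(count_pred0 s); apply: eq_count => y /=.
    by case: (a y); rewrite ?andbF.
  apply: eq_in_count => y ys /=; have := ab y ys.
  by case: (a y) => [->//|_]; rewrite ?andbT.
by rewrite -[ltnLHS]addn0 ltn_add2l -has_count; apply/hasP; exists x; rewrite //= ax.
Qed.

Lemma convex_hull_conv (R : realType) (V : lmodType R) (A : set V) (x y : V) (a : R) :
  0 <= a <= 1 -> convex_hull A x -> convex_hull A y ->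
  convex_hull A (a *: x + (1 - a) *: y).
Proof.
move=> a01 Ax Ay C [cC AC]; rewrite -in_setE.
have := cC x y (Itv01 (andP a01).1 (andP a01).2); apply; rewrite inE.
  exact: Ax.
exact: Ay.
Qed.

(** The finite form of the Krein-Milman argument, carried out in a subspace [F]
    without any choice of coordinates.  The last hypothesis says that the
    polyhedron contains no ray; it takes the place of both boundedness and
    finite dimension. *)
Section polyhedron.
Context {R : realType} {V : lmodType R} (F : set V) (H : seq (V -> R)).
Hypothesis FL : linear_subspace F.
Hypothesis HL : {in H, forall h, scalar h}.
Hypothesis Hpos : forall u, F u -> u != 0 -> exists2 h, h \in H & 0 < h u.

Definition polyhedron : set V := [set v | F v /\ forall h, h \in H -> h v <= 1].

Definition slack (v : V) := count (fun h : V -> R => h v != 1) H.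

(** The second condition, rather than extremality, is what makes the vertices
    finitely many: it lets a vertex be recovered from its set of tight
    constraints. *)
Definition vertex : set V := [set v | polyhedron v /\
  forall u, F u -> (forall h, h \in H -> h v = 1 -> h u = 0) -> u = 0].

Lemma finite_vertex : finite_set vertex.
Proof.
pose tight v : (size H).-tuple bool :=
  [tuple of map (fun h : V -> R => h v == 1) (in_tuple H)].
have tight_inj : {in vertex &, injective tight}.
  move=> v w; rewrite !inE => -[[Fv _] Ev] [[Fw _] _] [] /eq_in_map vw.
  apply/eqP; rewrite -subr_eq0; apply/eqP; apply: Ev; first exact: subspaceB.
  move=> h hH hv; rewrite (functionalB (HL hH)) hv.
  by have := vw h hH; rewrite hv eqxx => /esym/eqP ->; rewrite subrr.
rewrite -(eq_finite_set (inj_card_eq tight_inj)).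
exact: finite_finset.
Qed.

(** Moving from [v] along a direction that keeps the tight constraints tight, one
    has to leave the polyhedron, and at the exit point a further constraint has
    become tight. *)
Lemma hit_face v u : polyhedron v -> F u -> u != 0 ->
  (forall h, h \in H -> h v = 1 -> h u = 0) ->
  exists2 t, 0 < t & polyhedron (v + t *: u) /\ (slack (v + t *: u) < slack v)%N.
Proof.
move=> [Fv Pv] Fu u0 vu.
pose s := [seq h <- H | 0 < (h : V -> R) u].
have s0 : s != [::].
  have [h hH hu] := Hpos Fu u0.
  have : h \in s by rewrite mem_filter hu.
  by apply: contraTneq => ->.
(* [h0] is the first of the increasing constraints to be reached. *)
have [h0 + h0min] := exists_argmin (fun h : V -> R => (1 - h v) / h u) s0.
rewrite mem_filter => /andP[h0u h0H].
have h0v : h0 v < 1.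
  rewrite lt_neqAle Pv// andbT; apply/eqP => /(vu _ h0H) h0u0.
  by rewrite h0u0 ltxx in h0u.
set t := (1 - h0 v) / h0 u in h0min.
have t0 : 0 < t by rewrite divr_gt0// subr_gt0.
have hE h : h \in H -> h (v + t *: u) = h v + t * h u.
  by move=> hH; rewrite (functionalDZ (HL hH)).
exists t => //; split.
  split; first exact: (subspaceZD FL).
  move=> h hH; rewrite hE//; have [hu|hu] := ltP 0 (h u).
    rewrite -lerBrDl -ler_pdivlMr//; apply: h0min.
    by rewrite mem_filter hu.
  by rewrite (le_trans _ (Pv _ hH))// gerDl mulr_ge0_le0// ltW.
apply: (@count_lt _ _ _ _ h0) => //.
- move=> h hH; apply: contra => /eqP hv.
  by rewrite hE// vu// hv mulr0 addr0.
- by rewrite lt_eqF.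
- have -> : h0 (v + t *: u) = 1 by rewrite hE// /t divfK ?gt_eqF// subrKC.
  by rewrite eqxx.
Qed.

(** By induction on the number of slack constraints: a point that is not a vertex
    can be moved both forwards and backwards along some direction, and lies
    between the two exit points, which have fewer slack constraints. *)
Lemma polyhedron_polytope : polytope polyhedron.
Proof.
exists vertex; first exact: finite_vertex.
apply/seteqP; split; last first.
  apply: smallest_sub; last by move=> v [].
  move=> x y l; rewrite !inE => -[Fx Px] [Fy Py]; split.
    rewrite /conv/=; apply: (subspaceZD FL) => //.
    rewrite -[_ *: x]add0r; apply: (subspaceZD FL) => //.
    by case: FL => + _; rewrite inE.
  move=> h hH; rewrite /conv/= (functionalDZ (HL hH)) (functionalZ (HL hH)).
  have -> : 1 = l%:num + (1 - l%:num) :> R by rewrite subrKC.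
  by rewrite /unstable.onem lerD// ler_piMr ?subr_ge0 ?le1 ?ge0 ?(Px _ hH) ?(Py _ hH).
move=> v; have [k] := ubnP (slack v); elim: k v => // k IH v vk Pv.
have [Ev|] := pselect (vertex v); first exact: sub_gen_smallest.
move=> /not_andP[//|] /existsNP[u] /not_implyP[Fu] /not_implyP[vu] /eqP u0.
(* [v] is the barycentre of the exit points in the directions [u] and [- u]. *)
have [t1 t10 [P1 s1]] := hit_face Pv Fu u0 vu.
have [|||t2 t20 [P2 s2]] := @hit_face v (- u) Pv.
- exact: subspaceN.
- by rewrite oppr_eq0.
- by move=> h hH hv; rewrite (functionalN (HL hH)) vu// oppr0.
have t12 : 0 < t1 + t2 by rewrite addr_gt0.
set a := t2 / (t1 + t2).
have aE : a * t1 = (1 - a) * t2 by rewrite /a; field; rewrite gt_eqF.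
have -> : v = a *: (v + t1 *: u) + (1 - a) *: (v + t2 *: - u).
  by rewrite scalerN scalerDr scalerBr !scalerA aE addrACA -scalerDl subrKC
    scale1r subrr addr0.
apply: convex_hull_conv.
- by apply/andP; rewrite /a ler_pdivrMr// mul1r lerDr divr_ge0 ?ltW.
- by apply: IH => //; exact: leq_trans s1 _.
- by apply: IH => //; exact: leq_trans s2 _.
Qed.

End polyhedron.

(** * Norms that locally depend on finitely many functionals are polyhedral *)

Lemma linear_fun0 (R : pzRingType) (U V : lmodType R) (L : U -> V) :
  linear L -> L 0 = 0.
Proof. by move=> LL; have := LL (-1) 0 0; rewrite scaler0 addr0 scaleN1r addNr. Qed.

Lemma linear_rV_continuous (R : realType) (V : normedModType R) (n : nat)
  (L : 'rV[R]_n -> V) : linear L -> continuous L.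
Proof.
move=> LL.
pose L' : {linear 'rV[R]_n -> V} := HB.pack L (GRing.isLinear.Build _ _ _ _ L LL).
have -> : L = fun c => \sum_(i < n) c ord0 i *: L (delta_mx ord0 i).
  apply/funext => c; rewrite [in LHS](row_sum_delta c) -[L]/(L' : _ -> _).
  by rewrite linear_sum; apply: eq_bigr => i _; rewrite linearZ.
apply: continuous_big => [|i _ c].
  exact: add_continuous.
have := @coord_continuous R 1 n ord0 i c.
by move=> /(@cvgZr_tmp _ _ _ _ _ _ _ (L (delta_mx ord0 i))).
Qed.

(** Injectivity of the coordinate map is the point: it keeps the sphere of the
    coordinate space away from the kernel.  It is obtained by skipping every
    generator that the previous ones already span. *)
Lemma span_coordinates (R : realType) (V : lmodType R) (A : set V) :
  finite_set A -> exists n (L : 'rV[R]_n -> V),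
    [/\ linear L, injective L & range L = linear_span A].
Proof.
move=> /finite_seqP[s ->]; elim: s => [|a s [n [L [LL Linj Lspan]]]].
  exists 0%N, (fun=> 0); split.
  - by move=> a u v; rewrite scaler0 addr0.
  - by move=> u v _; apply/rowP => -[].
  - apply/seteqP; split=> [_ [_ _ <-] W [[W0 _] _]|v].
      by rewrite inE in W0.
    move=> v0; exists 0 => //; apply/esym; apply: (v0 [set 0]).
    split; last by move=> w /=; rewrite in_nil.
    split; first by rewrite inE.
    move=> b u w; rewrite !inE/= => -> ->.
    by rewrite scaler0 addr0.
have L0 := linear_fun0 LL.
have sub_s : linear_span [set` s] `<=` linear_span [set` a :: s].
  move=> v vs W [WL aW]; apply: vs; split => // w /= ws.
  by apply: aW => /=; rewrite inE ws orbT.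
have [[c _ La]|aL] := pselect (range L a).
  exists n, L; split=> //; rewrite Lspan; apply/seteqP; split => //.
  move=> v va W [WL sW]; apply: va; split => // w /=.
  rewrite inE => /predU1P[->|]; last exact: sW.
  suff : linear_span [set` s] a by apply.
  by rewrite -Lspan; exists c.
pose L' (c : 'rV[R]_(1 + n)) := L (rsubmx c) + c ord0 (lshift n ord0) *: a.
have LL' : linear L'.
  move=> b u v; rewrite /L' -[rsubmx (b *: u + v)]/(rsubmx _) linearP LL !mxE.
  by rewrite scalerDr scalerA scalerDl addrACA.
exists (1 + n)%N, L'; split=> //.
- move=> u v uv; apply/eqP; rewrite -subr_eq0; apply/eqP.
  have : L' (u - v) = 0.
    by rewrite -scaleN1r addrC LL' uv scaleN1r addNr.
  move: (u - v) => c; rewrite /L' => c0.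
  have [ca|ca] := eqVneq (c ord0 (lshift n ord0)) 0.
    move: c0; rewrite ca scale0r addr0 -L0 => /Linj rc.
    rewrite -[c]hsubmxK rc; apply/rowP => i; rewrite !mxE.
    case: splitP => j _; rewrite !mxE// (ord1 j); exact: ca.
  exfalso; apply: aL; exists (- (c ord0 (lshift n ord0))^-1 *: rsubmx c) => //.
  rewrite -[_ *: rsubmx c]addr0 LL L0 addr0.
  move/eqP: c0; rewrite addr_eq0 => /eqP ->.
  by rewrite scaleNr scalerN opprK scalerA mulVf// scale1r.
- apply/seteqP; split.
    move=> _ [c _ <-] W [WL sW]; apply: subspaceZD => //.
      have : range L (L (rsubmx c)) by exists (rsubmx c).
      by rewrite Lspan => /sub_s; apply.
    by apply: sW => /=; rewrite mem_head.
  apply: smallest_sub.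
    split; first by rewrite inE; exists 0; rewrite // -L0 /L' mxE scale0r addr0 linear0.
    move=> b x y; rewrite !inE => -[u _ <-] [v _ <-].
    by exists (b *: u + v); rewrite ?LL'.
  move=> v /=; rewrite inE => /predU1P[->|vs].
    exists (row_mx 1%:M 0) => //.
    by rewrite /L' row_mxKr L0 add0r row_mxEl mxE eqxx scale1r.
  have : range L v by rewrite Lspan; apply: sub_gen_smallest.
  move=> [c _ <-]; exists (row_mx 0 c) => //.
  by rewrite /L' row_mxKr row_mxEl mxE scale0r addr0.
Qed.

(** When all functionals have norm at most 1, this says that around each nonzero
    point the norm is the maximum of the absolute values of the finitely many
    functionals of a single level of [I]. *)
Definition locally_attained_on {R : realType} {Z : normedModType R}
    (I : nat -> seq (Z -> R)) :=
  forall z : Z, z != 0 -> exists m, \forall w \near z,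
    exists2 g, g \in I m & `|w| <= `|g w|.

(** Finitely many levels suffice for all of a finite-dimensional subspace, because
    they suffice on its compact unit sphere, and both sides are homogeneous. *)
Lemma finite_dim_norming (R : realType) (Z : normedModType R)
    (I : nat -> seq (Z -> R)) (F : set Z) :
  (forall m, {in I m, forall g, scalar g}) -> locally_attained_on I ->
  finite_dim_subspace F ->
  exists D : seq nat, forall v, F v -> v != 0 ->
    exists2 g, (exists2 m, m \in D & g \in I m) & `|v| <= `|g v|.
Proof.
move=> IL Iloc [A /span_coordinates[n [L [LL Linj LF]]] ->].
have Lc := linear_rV_continuous LL.
have L0 := linear_fun0 LL.
have LZ a c : L (a *: c) = a *: L c.
  by rewrite -[a *: c]addr0 LL L0 addr0.
pose S := [set c : 'rV[R]_n | `|c| = 1].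
pose U m := interior [set c : 'rV[R]_n | exists2 g, g \in I m & `|L c| <= `|g (L c)|].
have Scompact : compact S.
  apply: bounded_closed_compact.
    by exists 1; split => [|x x1 c /= ->]; rewrite ?real1// ltW.
  apply: (@preimage_closed _ _ (fun c : 'rV[R]_n => `|c|) [set 1]).
    by move=> c _; exact: norm_continuous.
  exact: closed_eq.
have SU : S `<=` \bigcup_(m in setT) U m.
  move=> c /= c1.
  have Lc0 : L c != 0.
    rewrite -L0 (inj_eq Linj); apply: contra_eq_neq c1 => ->.
    by rewrite normr0 eq_sym oner_neq0.
  have [m nm] := Iloc _ Lc0; exists m => //.
  exact: (Lc c _ nm).
have := Scompact; rewrite compact_cover => /(_ nat setT U).
case=> // [m _|D _ SD]; first exact: open_interior.
exists (finmap.enum_fset D) => v Fv v0.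
have : range L v by rewrite LF.
move=> [c _ cv].
have c0 : c != 0 by apply: contra_neq v0 => c0; rewrite -cv c0 L0.
have : S (`|c|^-1 *: c).
  by rewrite /S /= normrZ normfV normr_id mulVf// normr_eq0.
move=> /SD[m mD /interior_subset[g gI]].
rewrite LZ (functionalZ (IL m g gI)) normrM normrZ.
rewrite ler_pM2l ?normr_gt0 ?invr_eq0 ?normr_eq0// cv => gv.
by exists g => //; exists m.
Qed.

(** The unit ball of a finite-dimensional subspace is cut out by finitely many of
    the functionals and their opposites.  Since these control the norm, it
    contains no ray, so it is a polytope. *)
Lemma polyhedral_of_locally_attained (R : realType) (Z : normedModType R)
    (I : nat -> seq (Z -> R)) :
  (forall m, {in I m, forall g, scalar g}) ->
  (forall m, {in I m, forall g v, `|g v| <= `|v|}) ->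
  locally_attained_on I -> polyhedral Z.
Proof.
move=> IL I1 Iloc F Ffin.
have FL : linear_subspace F.
  case: Ffin => A _ ->; split.
    by rewrite inE => W [[+ _] _]; rewrite inE.
  move=> a u v; rewrite !inE => Fu Fv W WA; have [WL _] := WA.
  rewrite addrC; apply: subspaceZD => //; [exact: Fv|exact: Fu].
have [D ID] := finite_dim_norming IL Iloc Ffin.
pose G := flatten (map I D).
have GP g : g \in G -> scalar g /\ forall v, `|g v| <= `|v|.
  by move=> /flatten_mapP[m _ gI]; split; [exact: (IL m)|exact: (I1 m)].
pose H := G ++ map (fun g v => - g v) G.
have HL : {in H, forall h, scalar h}.
  move=> h; rewrite mem_cat => /orP[/GP[]//|/mapP[g /GP[gL _] ->]] a u v.
  by rewrite gL opprD mulrN.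
have Gv v : F v -> v != 0 -> exists2 g, g \in G & `|v| <= `|g v|.
  move=> Fv v0; have [g [m mD gI] gv] := ID v Fv v0.
  by exists g => //; apply/flatten_mapP; exists m.
have Hnorm v : F v -> v != 0 -> exists2 h, h \in H & `|v| <= h v.
  move=> Fv v0; have [g gG] := Gv v Fv v0.
  have [g0 vg|g0 vg] := ger0P (g v).
    by exists g => //; rewrite mem_cat gG.
  exists (fun w => - g w) => //; rewrite mem_cat; apply/orP; right.
  by apply/mapP; exists g.
suff -> : F `&` [set v | `|v| <= 1] = polyhedron F H.
  apply: polyhedron_polytope => // u Fu u0; have [h hH hu] := Hnorm u Fu u0.
  by exists h => //; rewrite (lt_le_trans _ hu)// normr_gt0.
apply/seteqP; split=> v [Fv].
  move=> /= v1; split => // h; rewrite mem_cat => /orP[/GP[_ gv]|/mapP[g /GP[_ gv] ->]].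
    exact: le_trans (ler_norm _) (le_trans (gv v) v1).
  by apply: le_trans (ler_norm _) _; rewrite normrN; exact: le_trans (gv v) v1.
move=> Hv; split => //=; have [->|v0] := eqVneq v 0; first by rewrite normr0.
by have [h hH hv] := Hnorm v Fv v0; rewrite (le_trans hv)// Hv.
Qed.

(** * Norms that locally depend on finitely many functionals: separability *)

(** Ekeland's variational principle.  The relation [S x y] below is a partial
    order.  One descends along a sequence that at each step covers at least half
    of the possible decrease of [phi]; such a sequence is Cauchy, and its limit
    is minimal for the order. *)
Lemma ekeland (R : realType) (Z : completeNormedModType R) (C : set Z)
    (phi : Z -> R) (e : R) :
  closed C -> C !=set0 -> continuous phi -> (forall x, 0 <= phi x) -> 0 < e ->
  exists2 x, C x & forall y, C y -> phi y + e * `|y - x| <= phi x -> y = x.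
Proof.
move=> Ccl [x0 Cx0] phic phi0 e0.
pose S x := [set y | C y /\ phi y + e * `|y - x| <= phi x].
have phiS x y : S x y -> phi y <= phi x.
  by move=> [_]; apply: le_trans; rewrite lerDl mulr_ge0// ltW.
have SS x y w : S x y -> S y w -> S x w.
  move=> [Cy yx] [Cw wy]; split => //.
  have wyx : `|w - x| <= `|w - y| + `|y - x|.
    by rewrite (_ : w - x = (w - y) + (y - x)) ?ler_normD// addrA subrK.
  have := ler_wpM2l (ltW e0) wyx; rewrite mulrDr; lra.
have Sxx x : C x -> S x x by move=> Cx; split=> //; rewrite subrr normr0 mulr0 addr0.
have step x : exists y, C x -> S x y /\ forall w, S x w -> 2 * phi y - phi x <= phi w.
  have [Cx|nCx] := pselect (C x); last by exists x.
  pose A := phi @` S x.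
  have Ainf : has_inf A.
    split; first by exists (phi x), x => //; exact: Sxx.
    by exists 0 => _ [y _ <-].
  have Ax : inf A <= phi x by apply: ge_inf; [exact: Ainf.2|exists x => //; exact: Sxx].
  have lbA w : S x w -> inf A <= phi w.
    by move=> Sw; apply: ge_inf; [exact: Ainf.2|exists w].
  have [xA|Ax'] := leP (phi x) (inf A).
    exists x => _; split; first exact: Sxx.
    by move=> w /lbA; lra.
  have := @inf_adherent _ A ((phi x - inf A) / 2) _ Ainf.
  case=> [|_ [y Sy <-] yA]; first lra.
  by exists y => _; split => // w /lbA; lra.
have [h hP] := choice step.
pose u n := iter n h x0.
have Cu n : C (u n).
  by elim: n => // n IH; have [[]] := hP _ IH.
have Su n m : (n <= m)%N -> S (u n) (u m).
  move=> /subnKC <-; elim: (m - n)%N => [|k IH]; first by rewrite addn0; exact: Sxx.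
  by rewrite addnS; apply: SS IH _; have [] := hP _ (Cu (n + k)%N).
pose A := range (phi \o u).
have Ainf : has_inf A.
  by split; [exists (phi (u 0%N)), 0%N|exists 0 => _ [n _ <-]; exact: phi0].
have lbA n : inf A <= phi (u n) by apply: ge_inf; [exact: Ainf.2|exists n].
have adA d : 0 < d -> exists n, phi (u n) < inf A + d.
  by move=> d0; have [_ [n _ <-] nA] := inf_adherent d0 Ainf; exists n.
have ucvg : cvg (u @ \oo).
  apply: cauchy_cvg; apply: cauchy_exP => d d0.
  have [N NA] := adA (e * d) (mulr_gt0 e0 d0).
  exists (u N); exists N => // n /= Nn.
  rewrite -ball_normE /= distrC -(ltr_pM2l e0).
  by have := (Su _ _ Nn).2; have := lbA n; lra.
pose x := lim (u @ \oo).
have Cx : C x.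
  by apply: (@closed_cvg _ _ _ _ u C Ccl _ x ucvg); exact: nearW.
have Sx n : S (u n) x.
  split=> //.
  have cv : (fun m => phi (u m) + e * `|u m - u n|) @ \oo --> phi x + e * `|x - u n|.
    apply: cvgD; first exact: (cvg_comp _ _ ucvg (phic x)).
    by apply: cvgZl_tmp; apply: cvg_norm; apply: cvgB => //; exact: cvg_cst.
  rewrite -(cvg_lim _ cv)//; apply: limr_le; first by apply/cvg_ex; eexists; exact: cv.
  by exists n => // m /= nm; exact: (Su _ _ nm).2.
exists x => // y Cy yx.
have Sy n : S (u n) y by apply: SS (Sx n) _.
have xy : phi x <= phi y.
  rewrite leNgt; apply/negP => yx'.
  have [|n nA] := adA (phi x - phi y); first by rewrite subr_gt0.
  have := (hP _ (Cu n)).2 _ (Sy n); have := lbA n.+1; rewrite /u /= -/(u n).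
  have := phiS _ _ (Sx n.+1).
  have : phi x <= inf A.
    by apply: lb_le_inf => [|_ [k _ <-]]; [exact: Ainf.1|exact/phiS/Sx].
  lra.
apply/eqP; rewrite -subr_eq0 -normr_le0 -(pmulr_rle0 _ e0); lra.
Qed.

(** A finite list of real functions maps [A] into a separable space.  The statement
    is about all sets [A] so that the induction on the list can be applied to the
    pieces of [A] on which the first function lies in a rational interval. *)
Lemma countable_approx (R : realType) (T : Type) (l : seq (T -> R)) (A : set T) :
  exists D : set T, [/\ countable D, D `<=` A & forall x (e : R), A x -> 0 < e ->
    exists2 w, D w & forall f, f \in l -> `|f w - f x| < e].
Proof.
elim: l A => [|f l IH] A.
  have [[a Aa]|A0] := pselect (A !=set0).
    by exists [set a]; split; [exact: countable1|move=> _ ->|move=> x e _ _; exists a].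
  exists set0; split => // x e Ax; case: A0; by exists x.
pose B (p : rat * rat) := A `&` [set x | ratr p.1 < f x < ratr p.2].
have [D DP] := choice (fun p => IH (B p)).
exists (\bigcup_p D p); split.
- by apply: bigcup_countable => [|p _]; [exact: countableP|have [] := DP p].
- by move=> x [p _ Dx]; have [_ /(_ _ Dx)[]] := DP p.
move=> x e Ax e0.
have [|p1] := @rat_in_itvoo R (f x - e / 2) (f x); first by lra.
have [|p2] := @rat_in_itvoo R (f x) (f x + e / 2); first by lra.
rewrite !in_itv /= => /andP[xp2 p2x] /andP[p1x xp1].
have [_ DB /(_ x e)[]//] := DP (p1, p2); first by split=> //=; rewrite xp1.
move=> w Dw wl; exists w; first by exists (p1, p2).
move=> g; rewrite inE => /predU1P[->|/wl//].
by have [_ /= /andP[? ?]] := DB _ Dw; rewrite ltr_norml; apply/andP; split; lra.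
Qed.

Lemma countable_range (T : pointedType) (A : set T) :
  countable A -> exists f : nat -> T, A `<=` range f.
Proof.
move=> /pfcard_geP[->|[f]]; first by exists (fun=> point).
by exists f => x Ax; have [n _ <-] := 'surj_f Ax; exists n.
Qed.

(** Choose a countable set whose elements approximate, for every level, the norm
    and the functionals of that level at every vector; let [D] be its rational
    span.  If the closure of [D] missed [y0], Ekeland's principle would give in
    it an [x] at which the distance to [y0] almost cannot decrease.  But around
    [z = y0 - x] the norm is a maximum of finitely many functionals, and some [w]
    in the countable set nearly agrees with [z] on those; moving [x] by a small
    multiple of [w] decreases all of them at once, hence the distance, at a
    definite rate. *)
Lemma separable_of_locally_attained (R : realType) (Z : completeNormedModType R)
    (I : nat -> seq (Z -> R)) :
  (forall m, {in I m, forall g, scalar g}) ->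
  (forall m, {in I m, forall g v, `|g v| <= `|v|}) ->
  locally_attained_on I ->
  exists2 D : set Z, countable D & closure D = setT.
Proof.
move=> IL I1 Iloc.
have [E EP] := choice (fun m => countable_approx ((Num.norm : Z -> R) :: I m) setT).
have [|e Ee] := @countable_range Z (\bigcup_m E m).
  by apply: bigcup_countable => [|m _]; [exact: countableP|have [] := EP m].
pose comb (s : seq (rat * nat)) := \sum_(p <- s) ratr p.1 *: e p.2.
pose D := range comb.
have clD x q j : closure D x -> closure D (x + ratr q *: e j).
  move=> Dx B xB.
  have : nbhs x ((fun u => u + ratr q *: e j) @^-1` B).
    by apply: (cvgD (@cvg_id _ _) (cvg_cst (ratr q *: e j))).
  move=> /Dx[_ [[s _ <-] Bs]]; exists (comb (rcons s (q, j))); split.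
    by exists (rcons s (q, j)).
  by rewrite /comb -cats1 big_cat big_seq1.
exists D; first by apply: sub_countable (card_image_le _ _) (countableP _).
apply/seteqP; split => // y0 _.
have [||||x Dx xmin] :=
  @ekeland _ _ (closure D) (fun x => `|y0 - x|) (1 / 4) (@closed_closure _ D).
- by exists 0; apply: subset_closure; exists [::] => //; rewrite /comb big_nil.
- by move=> x; apply: cvg_norm; apply: cvgB; [exact: cvg_cst|exact: cvg_id].
- by [].
- by [].
have [->//|xy0] := eqVneq y0 x.
have z0 : y0 - x != 0 by rewrite subr_eq0.
set z := y0 - x in z0.
have [m /nbhs_ballP[d /= d0 dz]] := Iloc _ z0.
have zp : 0 < `|z| by rewrite normr_gt0.
have [_ _ Em] := EP m.
(* The norm is approximated as well, to bound the length of the step. *)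
have [|w Ew wz] := Em z (`|z| / 4) Logic.I; first lra.
have wz1 : `|w| <= 5 / 4 * `|z|.
  by have := wz _ (mem_head _ _); rewrite ltr_norml => /andP[]; lra.
have [j _ ejw] : range e w by apply: Ee; exists m.
have [|q] := @rat_in_itvoo R 0 (Num.min 1 (d / (`|w| + 1))).
  by rewrite lt_min ltr01 divr_gt0// ltr_wpDl.
rewrite in_itv /= lt_min => /andP[q0 /andP[q1]].
have [t tE] : exists t : R, t = ratr q by exists (ratr q).
rewrite -tE in q0 q1 *; rewrite ltr_pdivlMr ?ltr_wpDl// => td.
have [|g gI] := dz (z - t *: w).
  rewrite -ball_normE /= opprB addrC subrK normrZ gtr0_norm//.
  by move: td; rewrite mulrDr; lra.
rewrite (functionalB (IL m g gI)) (functionalZ (IL m g gI)) => gz.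
have gwz : `|g w - g z| < `|z| / 4 by apply: wz; rewrite inE gI orbT.
(* The step [t *: w] gains [3 / 4 * (t * `|z|)] and has length at most
   [5 / 4 * (t * `|z|)], of which Ekeland's principle charges a quarter. *)
have {gz}ztw : `|z - t *: w| <= `|z| - 3 / 4 * (t * `|z|).
  apply: (le_trans gz).
  rewrite (_ : g z - t * g w = (1 - t) * g z - t * (g w - g z)); last by ring.
  have t1 : 0 <= 1 - t by rewrite subr_ge0 ltW.
  apply: (le_trans (ler_normB _ _)); rewrite !normrM (ger0_norm t1) (gtr0_norm q0).
  have := ler_wpM2l t1 (I1 m g gI z); have := ler_wpM2l (ltW q0) (ltW gwz); lra.
have tz : 0 < t * `|z| by rewrite mulr_gt0.
have xtw : x + t *: w = x.
  apply: xmin; first by rewrite tE -ejw; exact: clD.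
  rewrite opprD addrA -/z [x + _]addrC addrK normrZ gtr0_norm//.
  have := ler_wpM2l (ltW q0) wz1; lra.
move: ztw; rewrite (_ : t *: w = 0) ?subr0; first by lra.
by apply: (addrI x); rewrite xtw addr0.
Qed.

(** * Renorming a closed subspace *)

(** The new norm is only a seminorm outside the carrier, where it may vanish on
    nonzero vectors. *)
Structure renorming (R : realType) (V : completeNormedModType R) := Renorming {
  carrier : set V;
  newnorm : V -> R;
  ratio : R;
  carrier_linear : linear_subspace carrier;
  carrier_closed : closed carrier;
  newnormD : forall u v, newnorm (u + v) <= newnorm u + newnorm v;
  newnormZ : forall a v, newnorm (a *: v) = `|a| * newnorm v;
  newnorm_le : forall v, newnorm v <= ratio * `|v|;
  le_newnorm : forall v, carrier v -> `|v| <= newnorm v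
}.

Section renormed.
Context {R : realType} {V : completeNormedModType R} (p : renorming V).

Definition carrier_pred : {pred V} := mem (carrier p).

Record renormed := MkRenormed {
  renormed_val : V; _ : renormed_val \in carrier_pred }.

HB.instance Definition _ := [isSub for renormed_val].
HB.instance Definition _ := [Choice of renormed by <:].

Let carrier_submod_closed : submod_closed carrier_pred.
Proof. exact: carrier_linear. Qed.

HB.instance Definition _ :=
  GRing.isSubmodClosed.Build _ _ carrier_pred carrier_submod_closed.
HB.instance Definition _ := [SubChoice_isSubLmodule of renormed by <:].

Let norm (x : renormed) : R := newnorm p (val x).

Let normD x y : norm (x + y) <= norm x + norm y.
Proof. exact: newnormD. Qed.

Let normZ (a : R) x : norm (a *: x) = `|a| * norm x.
Proof. exact: newnormZ. Qed.

Lemma renormed_carrier (x : renormed) : carrier p (val x).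
Proof. by have := valP x; rewrite /= inE. Qed.

Let norm0_eq0 x : norm x = 0 -> x = 0.
Proof.
move=> x0; apply: val_inj; apply/eqP; rewrite -normr_le0 -x0.
exact: le_newnorm (renormed_carrier x).
Qed.

HB.instance Definition _ :=
  Lmodule_isNormed.Build R renormed normD normZ norm0_eq0.

End renormed.

Section renormed_theory.
Context {R : realType} {V : completeNormedModType R} (p : renorming V).

Lemma renormedE (x : renormed p) : `|x| = newnorm p (val x).
Proof. by []. Qed.

Lemma le_renormed (x : renormed p) : `|val x| <= `|x|.
Proof. exact: le_newnorm (renormed_carrier x). Qed.

Lemma renormed_le (x : renormed p) : `|x| <= ratio p * `|val x|.
Proof. exact: newnorm_le. Qed.

Lemma ratio_ball (e : R) : 0 < e -> exists2 d, 0 < d &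
  forall v : V, `|v| < d -> ratio p * `|v| < e.
Proof.
move=> e0; exists (e / (`|ratio p| + 1)); first by rewrite divr_gt0 ?ltr_wpDl.
move=> v; rewrite ltr_pdivlMr ?ltr_wpDl// => ve.
apply: le_lt_trans ve; rewrite mulrDr mulr1 mulrC -[leLHS]addr0 lerD//.
by rewrite ler_wpM2l// ler_norm.
Qed.

Lemma renormed_val_continuous : continuous (val : renormed p -> V).
Proof.
move=> x; apply: (@cvgrPdist_lt _ _ _ (nbhs x) _ _ _).2 => e e0; near=> y.
have : ball x e y by near: y; exact: nbhsx_ballx.
rewrite -ball_normE /=.
exact: le_lt_trans (le_renormed (x - y)).
Unshelve. all: by end_near. Qed.

(** The inclusion into [V] is a Lipschitz map with Lipschitz inverse onto a closed
    subspace. *)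
Lemma renormed_complete (F : set_system (renormed p)) :
  ProperFilter F -> cauchy F -> cvg F.
Proof.
move=> FF /cauchy_ballP Fc.
have : cvg ((val : renormed p -> V) @ F).
  apply: cauchy_cvg; apply/cauchy_ballP => e e0.
  have [[A B] /= [FA FB] AB] := Fc _ e0.
  exists (val @` A, val @` B).
    split; [apply: (@filterS _ F _ A) FA|apply: (@filterS _ F _ B) FB];
    by move=> x Ax; exists x.
  move=> [_ _] /= [[x Ax <-] [y By <-]]; have := AB (x, y) (conj Ax By).
  rewrite -!ball_normE /=.
  exact: le_lt_trans (le_renormed (x - y)).
move=> /cvg_ex[v Fv].
have cv : carrier p v.
  apply: (@closed_cvg _ _ F _ val _ (@carrier_closed _ _ p) _ v Fv).
  by apply: nearW => x; exact: renormed_carrier.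
have pv : v \in carrier_pred p by rewrite inE.
apply/cvg_ex; exists (MkRenormed pv); apply/cvgrPdist_lt => e e0.
have [d d0 dP] := ratio_ball e0.
have Fd : \forall x \near F, `|v - val x| < d by exact: cvgr_dist_lt.
near=> x.
by apply: le_lt_trans (renormed_le _) _; apply: dP; near: x.
Unshelve. all: by end_near. Qed.

HB.instance Definition _ := Uniform_isComplete.Build (renormed p) renormed_complete.

Lemma renormed_isomorphic : isomorphic_to_subspace (carrier p) (renormed p).
Proof.
exists (val : {linear renormed p -> V}), (insubd (0 : renormed p)); split.
- apply/seteqP; split=> [_ [x _ <-]|v pv]; first exact: renormed_carrier.
  have vp : v \in carrier_pred p by rewrite inE.
  by exists (MkRenormed vp).
- exact: valKd.
- exact: renormed_val_continuous.
- apply/subspace_continuousP => v pv; apply/cvgrPdist_lt => e e0.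
  have [d d0 dP] := ratio_ball e0.
  rewrite near_withinE; near=> w => pw.
  have : ball v d w by near: w; exact: nbhsx_ballx.
  rewrite -ball_normE /= => vw; apply: le_lt_trans (renormed_le _) _.
  by apply: dP; rewrite raddfB /= !insubdK ?inE.
Unshelve. all: by end_near. Qed.

End renormed_theory.

Section sup_of_functionals.
Context {R : realType} {V : normedModType R} (G : set (V -> R)) (K : R).
Hypothesis K0 : 0 <= K.
Hypothesis GL : forall g, G g -> scalar g.
Hypothesis GK : forall g, G g -> forall v, `|g v| <= K * `|v|.

Definition sup_norm (v : V) : R := sup [set `|g v| | g in G].

Lemma le_sup_norm g v : G g -> `|g v| <= sup_norm v.
Proof.
move=> Gg; apply: ub_le_sup; last by exists g.
by exists (K * `|v|) => _ [h Gh <-]; exact: GK.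
Qed.

Lemma sup_norm_le v k : 0 <= k -> (forall g, G g -> `|g v| <= k) -> sup_norm v <= k.
Proof.
move=> k0 vk; rewrite /sup_norm.
have [->|/set0P G0] := eqVneq [set `|g v| | g in G] set0; first by rewrite sup0.
by apply: ge_sup => // _ [g Gg <-]; exact: vk.
Qed.

Lemma sup_norm_ge0 v : 0 <= sup_norm v.
Proof.
rewrite /sup_norm; have [->|/set0P[_ [g Gg _]]] := eqVneq [set `|g v| | g in G] set0.
  by rewrite sup0.
exact: le_trans (normr_ge0 (g v)) (le_sup_norm v Gg).
Qed.

Lemma sup_normD u v : sup_norm (u + v) <= sup_norm u + sup_norm v.
Proof.
apply: sup_norm_le => [|g Gg]; first by rewrite addr_ge0 ?sup_norm_ge0.
rewrite -[u]scale1r (GL Gg) mul1r scale1r (le_trans (ler_normD _ _))//.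
by rewrite lerD ?le_sup_norm.
Qed.

Lemma sup_normZ (a : R) v : sup_norm (a *: v) = `|a| * sup_norm v.
Proof.
have le b w : sup_norm (b *: w) <= `|b| * sup_norm w.
  apply: sup_norm_le => [|g Gg]; first by rewrite mulr_ge0 ?sup_norm_ge0.
  by rewrite (functionalZ (GL Gg)) normrM ler_wpM2l ?le_sup_norm.
apply/eqP; rewrite eq_le le /=; have [->|a0] := eqVneq a 0.
  by rewrite normr0 mul0r sup_norm_ge0.
rewrite -ler_pdivlMl ?normr_gt0// -normfV.
by rewrite -{1}(scale1r v) -(mulVf a0) -scalerA le.
Qed.

Lemma sup_norm_leM v : sup_norm v <= K * `|v|.
Proof. by apply: sup_norm_le => [|g /GK]; rewrite ?mulr_ge0. Qed.

End sup_of_functionals.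

(** * Spaces whose norm is attained on almost compact sets of functionals *)

(** The bounds on the levels tend to 1 while at every nonzero vector of [Y] the
    norm is strictly exceeded at some level.  This strict excess makes all
    sufficiently high levels irrelevant near that vector. *)
Section boundary.
Context {R : realType} {V : completeNormedModType R} (Y : set V)
  (G : nat -> seq (V -> R)).
Hypothesis YL : linear_subspace Y.
Hypothesis Ycl : closed Y.
Hypothesis GL : forall n, {in G n, forall g, scalar g}.
Hypothesis GK : forall n, {in G n, forall g v, `|g v| <= (1 + n.+1%:R^-1) * `|v|}.
Hypothesis GY : forall y, Y y -> y != 0 ->
  exists n, exists2 g, g \in G n & `|y| < `|g y|.

Let allG : set (V -> R) := \bigcup_n [set` G n].

Let allGL g : allG g -> scalar g.
Proof. by move=> [n _] /(GL (n := n)). Qed.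

Let allGK g : allG g -> forall v, `|g v| <= 2 * `|v|.
Proof.
move=> [n _] /(GK (n := n)) gn v; apply: le_trans (gn v) _.
by rewrite ler_wpM2r// (_ : 2 = 1 + 1)// lerD2l invf_le1// ler1n.
Qed.

Let N := sup_norm allG.

Let le_N v : Y v -> `|v| <= N v.
Proof.
move=> Yv; have [->|v0] := eqVneq v 0.
  by rewrite normr0; exact: (sup_norm_ge0 allGK).
have [n [g gn /ltW vg]] := GY Yv v0.
by apply: le_trans vg _; apply: (le_sup_norm allGK); exists n.
Qed.

Definition boundary_renorming : renorming V :=
  @Renorming R V Y N 2 YL Ycl (sup_normD allGL allGK)
    (sup_normZ allGL allGK) (sup_norm_leM (ler0n _ _) allGK) le_N.

Let Z := renormed boundary_renorming.

Definition boundary_upto (m : nat) : seq (Z -> R) :=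
  [seq g \o val | g <- flatten [seq G n | n <- iota 0 m.+1]].

Lemma mem_boundary_upto m g : g \in boundary_upto m ->
  exists2 h, allG h & g = h \o val.
Proof.
move=> /mapP[h /flatten_mapP[n _ hn] ->]; exists h => //.
by exists n.
Qed.

Lemma boundary_scalar m : {in boundary_upto m, forall g, scalar g}.
Proof.
move=> _ /mem_boundary_upto[h /allGL hL ->] a u v.
exact: hL.
Qed.

Lemma boundary_le m : {in boundary_upto m, forall g v, `|g v| <= `|v|}.
Proof.
move=> _ /mem_boundary_upto[h hG ->] v.
exact: (le_sup_norm allGK).
Qed.

(** If [g0] exceeds the norm at [y], then for large [m] it still exceeds
    [1 + 1 / m.+1] times the norm on a neighbourhood of [y].  There it beats all
    functionals of levels above [m], so the supremum is taken over finitely many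
    of them. *)
Lemma boundary_locally_attained : locally_attained_on boundary_upto.
Proof.
have gap (c a b u v D : R) : 0 <= c -> c <= 2 -> 0 <= D -> a <= b + 2 * D ->
    u <= v + D -> D < (a - c * v) / 4 -> c * u < b.
  move=> c0 c2 D0 ab uw Da; have := ler_wpM2l c0 uw; have := ler_wpM2r D0 c2.
  by rewrite mulrDr; lra.
move=> x x0; set y := val x.
have y0 : y != 0 by rewrite -(raddf0 (val : {linear Z -> V})) (inj_eq val_inj).
have [n0 [g0 g0n yg0]] := GY (renormed_carrier x) y0.
rewrite -/y in yg0.
have yp : 0 < `|y| by rewrite normr_gt0.
have [k yk] : exists k, 1 + k.+1%:R^-1 < `|g0 y| / `|y|.
  by apply: ltr_add_invr; rewrite ltr_pdivlMr// mul1r.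
rewrite ltr_pdivlMr// in yk.
pose m := maxn n0 k.
have ym : (1 + m.+1%:R^-1) * `|y| < `|g0 y|.
  apply: le_lt_trans yk; rewrite ler_wpM2r// lerD2l lef_pV2 ?posrE ?ltr0n//.
  by rewrite ler_nat ltnS leq_maxr.
pose d := (`|g0 y| - (1 + m.+1%:R^-1) * `|y|) / 4.
have d0 : 0 < d by rewrite divr_gt0// subr_gt0.
exists m; near=> w.
have : ball x d w by near: w; exact: nbhsx_ballx.
rewrite -ball_normE /= => xw.
have {}xw : `|y - val w| < d by exact: le_lt_trans (le_renormed (x - w)) xw.
have g0L : scalar g0 := GL g0n.
have g0G : allG g0 by exists n0.
set v := val w in xw *.
have s2 : 1 + m.+1%:R^-1 <= 2 :> R.
  by rewrite (_ : 2 = 1 + 1)// lerD2l invf_le1// ler1n.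
have s0 : 0 <= 1 + m.+1%:R^-1 :> R by rewrite addr_ge0.
have vg0 : (1 + m.+1%:R^-1) * `|v| < `|g0 v|.
  have h1 : `|g0 y| <= `|g0 v| + 2 * `|y - v|.
    have := allGK g0G (y - v); rewrite (functionalB g0L) => h.
    rewrite -lerBlDl (le_trans _ h)//.
    exact: lerB_dist.
  have h2 : `|v| <= `|y| + `|y - v|.
    by rewrite (distrC y) -lerBlDl; exact: lerB_dist.
  exact: (gap _ _ _ _ _ _ s0 s2 _ h1 h2 xw).
pose J := flatten [seq G n | n <- iota 0 m.+1].
have JP h n : (n <= m)%N -> h \in G n -> h \in J.
  by move=> nm hn; apply/flatten_mapP; exists n; rewrite // mem_iota ltnS nm.
have g0J : g0 \in J by apply: JP g0n; rewrite leq_maxl.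
have [|g gJ gmax] := exists_argmin (fun g : V -> R => - `|g v|) (s := J).
  by apply: contraTneq g0J => ->.
exists (g \o val); first by apply/mapP; exists g.
rewrite renormedE /= -/v; apply: sup_norm_le => // h [n _ hn].
have [nm|mn] := leqP n m; first by have := gmax h (JP _ _ nm hn); rewrite lerN2.
apply: le_trans (GK hn v) _; have := gmax g0 g0J; rewrite lerN2; apply: le_trans.
apply: le_trans (ltW vg0); rewrite ler_wpM2r// lerD2l lef_pV2 ?posrE ?ltr0n//.
by rewrite ler_nat ltnS ltnW.
Unshelve. all: by end_near. Qed.

Theorem separable_isomorphic_polyhedral : separable_set Y /\
  exists2 Z : completeNormedModType R, polyhedral Z & isomorphic_to_subspace Y Z.
Proof.
split; last first.
  exists Z; last exact: (renormed_isomorphic boundary_renorming).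
  exact: polyhedral_of_locally_attained boundary_scalar boundary_le
    boundary_locally_attained.
have [D Dc DZ] := separable_of_locally_attained boundary_scalar boundary_le
  boundary_locally_attained.
exists (val @` D); first exact: sub_countable (card_image_le _ _) Dc.
split=> [_ [x _ <-]|y Yy B yB]; first exact: (renormed_carrier x).
have yp : y \in carrier_pred boundary_renorming by rewrite inE.
have : closure D (MkRenormed yp) by rewrite DZ.
move=> /(_ (val @^-1` B))[|x [Dx Bx]]; last by exists (val x); split => //; exists x.
exact: (@renormed_val_continuous _ _ boundary_renorming (MkRenormed yp)).
Qed.

End boundary.

(** * Molecules over the nets of a sigma-precompact space *)

(** Slopes of Lipschitz functions, inflated by a factor which exceeds 1 and tends
    to 1 with the level. *)
Definition molecule {R : realType} {M : metricType R} (z : M) (n : nat)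
    (q : M * M) (f : Lip0 z) : R :=
  (1 + n.+1%:R^-1) * ((f q.1 - f q.2) / mdist q.1 q.2).

Lemma molecule_scalar {R : realType} {M : metricType R} (z : M) n q :
  scalar (molecule (z := z) n q).
Proof.
move=> a f g; rewrite /molecule /= !fctE /GRing.scale /=; ring.
Qed.

Lemma molecule_le {R : realType} {M : metricType R} (z : M) n q (f : Lip0 z) :
  `|molecule n q f| <= (1 + n.+1%:R^-1) * `|f|.
Proof.
rewrite /molecule normrM ger0_norm ?addr_ge0// ler_wpM2l ?addr_ge0//.
rewrite normrM normfV (ger0_norm (mdist_ge0 _ _)).
have [->|q0] := eqVneq (mdist q.1 q.2) 0; first by rewrite invr0 mulr0.
rewrite ler_pdivrMr; first exact: lip_normP.
by rewrite lt_neqAle eq_sym q0 mdist_ge0.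
Qed.

(** [E n] is a net of the union of the first [n.+1] totally bounded pieces, so each
    point is approximated at all levels from some level on. *)
Lemma sigma_precompact_nets {R : realType} {M : metricType R} (r : nat -> R) :
  sigma_precompact M -> (forall n, 0 < r n) ->
  exists E : nat -> seq M, forall x, exists k, forall n, (k <= n)%N ->
    exists2 x', x' \in E n & mdist x' x < r n.
Proof.
move=> [A Atb AT] r0.
have net (p : nat * nat) : exists s : seq M, forall x, A p.1 x ->
    exists2 x', x' \in s & mdist x' x < r p.2.
  have [F /finite_seqP[s ->] AF] := Atb p.1 _ (r0 p.2).
  by exists s => x /AF[x' /= x's]; rewrite ballEmdist /= => x'x; exists x'.
have [s sP] := choice net.
exists (fun n => flatten [seq s (i, n) | i <- iota 0 n.+1]) => x.
have [i _ Aix] : (\bigcup_n A n) x by rewrite AT.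
exists i => n le_in; have [x' x's x'x] := sP (i, n) x Aix.
by exists x' => //; apply/flatten_mapP; exists i; rewrite // mem_iota ltnS le_in.
Qed.

(** If the norm is attained at [x] and [y], replacing both by points at distance
    less than [r = s ^+ 2 / 8] multiplies the slope by at least
    [(d - 2 * r) / (d + 2 * r)] with [d] the distance of [x] and [y].  As [s <= d]
    and [s <= 1], this is compensated by the factor [1 + s]. *)
Lemma molecule_gt {R : realType} {M : metricType R} (z : M) (n : nat)
    (f : Lip0 z) (x y x' y' : M) :
  let s : R := n.+1%:R^-1 in
  f != 0 -> x != y -> `|f| = `|f x - f y| / mdist x y -> s <= mdist x y ->
  mdist x' x < s ^+ 2 / 8 -> mdist y' y < s ^+ 2 / 8 ->
  `|f| < `|molecule n (x', y') f|.
Proof.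
move=> s f0 xy fxy sd xx' yy'.
have s0 : 0 < s by rewrite invr_gt0 ltr0n.
have s1 : s <= 1 by rewrite invf_le1// ler1n.
have fp : 0 < `|f| by rewrite normr_gt0.
have d0 : 0 < mdist x y by rewrite mdist_gt0.
have fd : `|f x - f y| = `|f| * mdist x y by rewrite fxy divfK ?gt_eqF.
set d := mdist x y in sd d0 fd fxy.
have d' : mdist x' y' <= d + s ^+ 2 / 4.
  have := metric_triangle x' x y'; have := metric_triangle x y y'.
  rewrite (metric_sym y y') -/d; lra.
have hx : `|f x - f x'| <= `|f| * (s ^+ 2 / 8).
  apply: le_trans (lip_normP f x x') _; apply: ler_wpM2l; first exact: lip_norm_ge0.
  by rewrite metric_sym ltW.
have hy : `|f y - f y'| <= `|f| * (s ^+ 2 / 8).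
  apply: le_trans (lip_normP f y y') _; apply: ler_wpM2l; first exact: lip_norm_ge0.
  by rewrite metric_sym ltW.
have a0 : `|f| * (d - s ^+ 2 / 4) <= `|f x' - f y'|.
  have : `|f x - f y| <= `|f x - f x'| + `|f x' - f y'| + `|f y - f y'|.
    rewrite (_ : f x - f y = (f x - f x') + (f x' - f y') - (f y - f y')); last by ring.
    by rewrite (le_trans (ler_normB _ _))// lerD2r ler_normD.
  rewrite fd mulrBr; lra.
have ss : s ^+ 2 <= s * d by rewrite expr2 ler_wpM2l// ltW.
have ss0 : 0 < s ^+ 2 by rewrite exprn_gt0.
have sss : s * s ^+ 2 <= s ^+ 2 by rewrite ler_piMl// ltW.
have sd' : s ^+ 2 <= d by rewrite (le_trans ss)// ler_piMl// ltW.
have key : `|f| * mdist x' y' < (1 + s) * `|f x' - f y'|.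
  apply: (@lt_le_trans _ _ ((1 + s) * (`|f| * (d - s ^+ 2 / 4)))); last first.
    by rewrite ler_wpM2l// addr_ge0// ltW.
  rewrite mulrCA ltr_pM2l//; nra.
have d'0 : 0 < mdist x' y'.
  rewrite lt_neqAle mdist_ge0 andbT eq_sym; apply/negP => /eqP/mdist_positivity xy'.
  move: a0; rewrite xy' subrr normr0 leNgt => /negP; apply.
  by rewrite mulr_gt0//; lra.
rewrite /molecule /= -/s normrM normrM normfV (gtr0_norm d'0) mulrA.
by rewrite ltr_pdivlMr// (ger0_norm (addr_ge0 ler01 (ltW s0))).
Qed.

Theorem theorem3p7 (R : realType) (M : metricType R) (z : M)
    (M2 : exists x y : M, x != y)
    (sM : sigma_precompact M)
    (Y : set (Lip0 z))
    (linY : linear_subspace Y) (clY : closed Y)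
    (YSNA : Y `<=` SNA z) :
  separable_set Y /\
  exists2 Z : completeNormedModType R,
    polyhedral Z & isomorphic_to_subspace Y Z.
Proof.
have [|E EP] := sigma_precompact_nets (r := fun n => n.+1%:R^-1 ^+ 2 / 8) sM.
  by move=> n; rewrite divr_gt0// exprn_gt0// invr_gt0 ltr0n.
apply: (separable_isomorphic_polyhedral
  (G := fun n => [seq molecule n q | q <- [seq (x, y) | x <- E n, y <- E n]])) => //.
- by move=> n g /mapP[q _ ->]; exact: molecule_scalar.
- by move=> n g /mapP[q _ ->] f; exact: molecule_le.
move=> f /YSNA[x [y [xy fxy]]] f0.
have [i iP] := EP x; have [j jP] := EP y.
have [k] : exists k, 0 + k.+1%:R^-1 < mdist x y.
  by apply: ltr_add_invr; rewrite mdist_gt0.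
rewrite add0r => kxy.
pose n := maxn k (maxn i j).
have [x' x'E xx'] := iP n (leq_trans (leq_maxl i j) (leq_maxr k _)).
have [y' y'E yy'] := jP n (leq_trans (leq_maxr i j) (leq_maxr k _)).
exists n, (molecule n (x', y')).
  by apply/mapP; exists (x', y') => //; exact: allpairs_f.
apply: molecule_gt xy fxy _ xx' yy' => //.
rewrite (le_trans _ (ltW kxy))// lef_pV2 ?posrE ?ltr0n// ler_nat ltnS.
exact: leq_maxl.
Qed.
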